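(* Let $G$ be a compact Hausdorff topological group and let $\eta:G*X\to X$ be a continuous partial action of $G$ on a topological space $X$ such that $G*X$ is closed in $G\times X$. Then: (i) the map $\eta:G*X\to X$ is closed; (ii) the quotient map $\pi_G:X\to X/\!\sim_G$ of $\eta$ and the quotient map $\hat\pi_G:G\times X\to (G\times X)/\!\sim_G$ of the partial action $\hat\eta$ of $G$ on $G\times X$ are perfect.
   Context: A partial action of $G$ on $X$ is a function $\eta:G*X\to X$ with domain $G*X\subseteq G\times X$, written $g\cdot x=\eta(g,x)$, where ''$\exists g\cdot x$'' means $(g,x)\in G*X$, such that for all $g,h\in G$, $x\in X$: (PA1) if $\exists g\cdot x$ then $\exists g^{-1}\cdot(g\cdot x)$ and $g^{-1}\cdot(g\cdot x)=x$; (PA2) if $\exists g\cdot(h\cdot x)$ (in particular $\exists h\cdot x$) then $\exists (gh)\cdot x$ and $g\cdot(h\cdot x)=(gh)\cdot x$; (PA3) $\exists 1\cdot x$ and $1\cdot x=x$. Put $X_g=\{x\in X\mid \exists g^{-1}\cdot x\}$ and let $\eta_g:X_{g^{-1}}\to X_g$, $x\mapsto g\cdot x$, which is a bijection. All partial actions are assumed topological: every $X_g$ is open in $X$ and every $\eta_g$ is a homeomorphism. The partial action is continuous if $\eta:G*X\to X$ is continuous, where $G*X$ has the subspace topology from the product $G\times X$. Orbit equivalence relation of a partial action: $x\sim_G y$ iff there is $g\in G$ with $\exists g\cdot x$ and $g\cdot x=y$. The orbit space $X/\!\sim_G$ has the quotient topology and $\pi_G:X\to X/\!\sim_G$ is the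 quotient map. The partial action $\hat\eta$ of $G$ on $G\times X$ is given by $(G\times X)_g=G\times X_g$ and $\hat\eta_g:G\times X_{g^{-1}}\to G\times X_g$, $(h,x)\mapsto (hg^{-1},\eta_g(x))$, for $g\in G$; $\hat\pi_G$ is the quotient map onto its orbit space. A continuous surjection $f:A\to B$ is perfect if it is closed and $f^{-1}(\{b\})$ is compact for all $b\in B$. *)

(* Defs.v *)
From HB Require Import structures.
From mathcomp Require Import all_boot all_classical.
From mathcomp Require Import topology.

Set Implicit Arguments.
Unset Strict Implicit.
Unset Printing Implicit Defensive.

Local Open Scope classical_set_scope.
Local Open Scope quotient_scope.

HB.mixin Record Group_Topological_isTopologicalGroup G
    of Group G & Topological G := {
  mulg_continuous : continuous (fun z : G * G => (z.1 * z.2)%g) ;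
  invg_continuous : continuous (fun z : G => (z^-1)%g)
}.

#[short(type="topologicalGroupType")]
HB.structure Definition TopologicalGroup :=
  {G of Group G & Topological G & Group_Topological_isTopologicalGroup G}.

Definition closed_map (A B : topologicalType) (f : A -> B) : Prop :=
  forall C : set A, closed C -> closed (f @` C).

Definition perfect_map (A B : topologicalType) (f : A -> B) : Prop :=
  [/\ continuous f, range f = [set: B], closed_map f
    & forall b : B, compact (f @^-1` [set b])].

Definition homeomorphism (A B : topologicalType) (f : A -> B) : Prop :=
  continuous f /\
  exists g : B -> A, [/\ cancel f g, cancel g f & continuous g].

(* The map is defined on the subtype of its domain [pa_dom], so that (as a
   [set_type]) it carries the subspace topology of the product.  A hypothesis
   [(g, x) \in pa_dom] is "g . x is defined". *)
Record partial_action (G : groupType) (X : Type) := PartialAction {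
  pa_dom : set (G * X) ;
  pa_map :> pa_dom -> X ;
  pa_act := fun g x (gx : (g, x) \in pa_dom) => pa_map (exist _ (g, x) gx) ;
  pa1 : forall g x (gx : (g, x) \in pa_dom),
    exists gVgx : (g^-1%g, pa_act gx) \in pa_dom, pa_act gVgx = x ;
  pa2 : forall g h x (hx : (h, x) \in pa_dom)
      (ghx : (g, pa_act hx) \in pa_dom),
    exists gh_x : ((g * h)%g, x) \in pa_dom, pa_act ghx = pa_act gh_x ;
  pa3 : forall x, exists ex : (1%g, x) \in pa_dom, pa_act ex = x
}.
Arguments pa_map {G X} p _.

Section PartialActionTheory.
Context {G : groupType} {X : Type} (eta : partial_action G X).

Definition pa_at (g : G) : set X := [set x | pa_dom eta (g^-1%g, x)].

Lemma pa_at_dom (g : G) (x : pa_at g^-1%g) : (g, val x) \in pa_dom eta.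
Proof. by case: x => x /= /set_mem; rewrite /pa_at /= invgK => /mem_set. Qed.

Lemma pa_act_at (g : G) (x : pa_at g^-1%g) :
  pa_act (pa_at_dom x) \in pa_at g.
Proof. by have [/set_mem gVgx _] := pa1 (pa_at_dom x); apply/mem_set. Qed.

Definition pa_fun (g : G) (x : pa_at g^-1%g) : pa_at g :=
  exist _ (pa_act (pa_at_dom x)) (pa_act_at x).

Definition pa_orbit_rel (x y : X) : Prop :=
  exists (g : G) (gx : (g, x) \in pa_dom eta), pa_act gx = y.

Lemma pa_act_eq g g' x x' (gx : (g, x) \in pa_dom eta)
    (gx' : (g', x') \in pa_dom eta) :
  g = g' -> x = x' -> pa_act gx = pa_act gx'.
Proof.
by move=> eg ex; subst g' x'; rewrite (bool_irrelevance gx gx').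
Qed.

Lemma pa_orbit_refl : reflexive (fun x y => `[< pa_orbit_rel x y >]).
Proof. by move=> x; apply/asboolP; exists 1%g; exact: pa3. Qed.

Lemma pa_orbit_sym : symmetric (fun x y => `[< pa_orbit_rel x y >]).
Proof.
suff sym x y : pa_orbit_rel x y -> pa_orbit_rel y x.
  by move=> x y; apply/asboolP/asboolP => /sym.
by move=> [g [gx <-]]; exists g^-1%g; exact: pa1.
Qed.

Lemma pa_orbit_trans : transitive (fun x y => `[< pa_orbit_rel x y >]).
Proof.
move=> y x z /asboolP[h [hx hxy]] /asboolP[g [gy gyz]]; apply/asboolP.
subst y; exists (g * h)%g; have [ghx e] := pa2 gy.
by exists ghx; rewrite -e.
Qed.

End PartialActionTheory.
Arguments pa_fun {G X} eta g x.

Definition pa_topological (G : groupType) (X : topologicalType)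
    (eta : partial_action G X) : Prop :=
  forall g : G, open (pa_at eta g) /\ homeomorphism (pa_fun eta g).

Section OrbitSpace.
Context {G : groupType} {X : topologicalType} (eta : partial_action G X).

Definition pa_orbit_equiv : equiv_rel X :=
  EquivRel (fun x y => `[< pa_orbit_rel eta x y >])
    (pa_orbit_refl eta) (pa_orbit_sym eta) (pa_orbit_trans (eta := eta)).

Definition orbit_space : topologicalType :=
  quotient_topology {eq_quot pa_orbit_equiv}.

Definition orbit_map : X -> orbit_space :=
  \pi_(quotient_topology {eq_quot pa_orbit_equiv}).

Lemma orbit_map_eqP (x y : X) :
  orbit_map x = orbit_map y <-> pa_orbit_rel eta x y.
Proof.
split=> [/(eqmodP pa_orbit_equiv)/asboolP //|xy].
by apply/(eqmodP pa_orbit_equiv)/asboolP.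
Qed.

End OrbitSpace.

Section HatAction.
Context {G : groupType} {X : Type} (eta : partial_action G X).

Definition hat_dom : set (G * (G * X)) :=
  [set p | pa_dom eta (p.1, p.2.2)].

Lemma hat_domP (p : hat_dom) :
  ((val p).1, (val p).2.2) \in pa_dom eta.
Proof. by case: p => p /= /set_mem /mem_set. Qed.

Definition hat_map (p : hat_dom) : G * X :=
  (((val p).2.1 * (val p).1^-1)%g, pa_act (hat_domP p)).

Lemma hat_mapE (g h : G) (x : X) (ghx : (g, (h, x)) \in hat_dom)
    (gx : (g, x) \in pa_dom eta) :
  hat_map (exist _ (g, (h, x)) ghx) = ((h * g^-1)%g, pa_act gx).
Proof. by congr pair; exact: pa_act_eq. Qed.

Lemma hat_pa1 (g : G) (z : G * X) (gz : (g, z) \in hat_dom) :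
  exists gVgz : (g^-1%g, hat_map (exist _ (g, z) gz)) \in hat_dom,
    hat_map (exist _ (g^-1%g, hat_map (exist _ (g, z) gz)) gVgz) = z.
Proof.
case: z gz => k x gz.
have gx : (g, x) \in pa_dom eta by exact/mem_set/(set_mem gz).
rewrite (hat_mapE gz gx); have [gVgx e] := pa1 gx.
exists (mem_set (set_mem gVgx : hat_dom (g^-1%g, ((k * g^-1)%g, pa_act gx)))).
by rewrite (hat_mapE _ gVgx) e invgK mulgVK.
Qed.

Lemma hat_pa2 (g h : G) (z : G * X) (hz : (h, z) \in hat_dom)
    (ghz : (g, hat_map (exist _ (h, z) hz)) \in hat_dom) :
  exists gh_z : ((g * h)%g, z) \in hat_dom,
    hat_map (exist _ (g, hat_map (exist _ (h, z) hz)) ghz) =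
    hat_map (exist _ ((g * h)%g, z) gh_z).
Proof.
case: z hz ghz => k x hz.
have hx : (h, x) \in pa_dom eta by exact/mem_set/(set_mem hz).
rewrite (hat_mapE hz hx) => ghz.
have ghx : (g, pa_act hx) \in pa_dom eta by exact/mem_set/(set_mem ghz).
have [gh_x e] := pa2 ghx.
exists (mem_set (set_mem gh_x : hat_dom ((g * h)%g, (k, x)))).
by rewrite (hat_mapE _ ghx) (hat_mapE _ gh_x) e invgM mulgA.
Qed.

Lemma hat_pa3 (z : G * X) : exists ez : (1%g, z) \in hat_dom,
  hat_map (exist _ (1%g, z) ez) = z.
Proof.
case: z => k x; have [ex e] := pa3 eta x.
exists (mem_set (set_mem ex : hat_dom (1%g, (k, x)))).
by rewrite (hat_mapE _ ex) e invg1 mulg1.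
Qed.

Definition pa_hat : partial_action G (G * X) :=
  PartialAction (pa_map := hat_map) hat_pa1 hat_pa2 hat_pa3.

Lemma pa_at_hat (g : G) : pa_at pa_hat g = [set: G] `*` pa_at eta g.
Proof. by apply/seteqP; split=> -[k x] //= []. Qed.

Lemma pa_hatE (g h : G) (x : X) (ghx : (g, (h, x)) \in pa_dom pa_hat)
    (gx : (g, x) \in pa_dom eta) :
  pa_act ghx = ((h * g^-1)%g, pa_act gx).
Proof. by congr pair; exact: pa_act_eq. Qed.

End HatAction.

(* Main.v *)
Require Import Defs.
From HB Require Import structures.
From mathcomp Require Import all_boot all_classical.
From mathcomp Require Import topology.

Set Implicit Arguments.
Unset Strict Implicit.
Unset Printing Implicit Defensive.

Local Open Scope classical_set_scope.

(** The action map is a projection in disguise.  The involution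
    (g, x) |-> (g^-1, g . x) of G * X carries x to g . x, so eta is the
    composite of this homeomorphism, the inclusion of the closed set G * X
    into G x X, and the projection G x X -> X.  The inclusion of a closed
    subspace is a closed map ([closed_map_set_val]), and the projection is
    closed because G is compact ([closed_map_snd], the tube lemma); hence eta
    is closed ([closed_pa_map]).

    The saturation of a set C under the orbit relation is the image under eta
    of the part of G * X lying over C, so it is closed when C is; this is what
    it means for the orbit map to be closed ([closed_orbit_map]).  The fibres
    of the orbit map are the orbits, and the orbit of x is the image under
    eta of the compact set (G x {x}) `&` (G * X) ([compact_orbit]).

    The statement about the action on G x X needs no separate argument: that
    action again has a closed domain and is continuous, so the result for an
    arbitrary space applies with G x X in place of X. *)

Lemma set_val_continuous (X : topologicalType) (A : set X) :
  continuous (set_val : A -> X).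
Proof. exact: initial_continuous. Qed.

Lemma continuous_to_set_type (X Y : topologicalType) (A : set Y) (f : X -> A) :
  continuous (set_val \o f) -> continuous f.
Proof. by move=> fc; exact: (@continuous_comp_initial A X Y set_val f fc). Qed.

Lemma continuous_pair (X Y Z : topologicalType) (f : X -> Y) (g : X -> Z) :
  continuous f -> continuous g -> continuous (fun x => (f x, g x)).
Proof. by move=> fc gc x; apply: cvg_pair; [exact: fc|exact: gc]. Qed.

Lemma continuous_funcomp (X Y Z : topologicalType) (f : X -> Y) (g : Y -> Z) :
  continuous f -> continuous g -> continuous (g \o f).
Proof. by move=> fc gc x; apply: continuous_comp; [exact: fc|exact: gc]. Qed.

Lemma fst_continuous (X Y : topologicalType) : continuous (@fst X Y).
Proof. by move=> x; exact: cvg_fst. Qed.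

Lemma snd_continuous (X Y : topologicalType) : continuous (@snd X Y).
Proof. by move=> x; exact: cvg_snd. Qed.

(** The tube lemma: a point y outside the image has K x {y} inside the open
    complement of C, and compactness of the factor K yields one
    neighbourhood of y that works for all k at once. *)
Lemma closed_map_snd (K X : topologicalType) :
  compact [set: K] -> closed_map (@snd K X).
Proof.
move=> /compact_near_coveringP Kcov C Ccl.
rewrite -openC openE => y /= yC; rewrite /interior.
have : \forall x \near y, [set: K] `<=` (fun k => (~` C) (k, x)).
  apply: (Kcov X (nbhs y) (fun x k => (~` C) (k, x))) => k _.
  have kyC : (~` C) (k, y) by move=> Cky; apply: yC; exists (k, y).
  have : nbhs (k, y) (~` C).
    by apply: open_nbhs_nbhs; split=> //; exact: closed_openC.
  by apply: filterS => -[].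
by apply: filterS => x xC [[k x'] Ckx /= ex]; subst x'; exact: (xC k I Ckx).
Qed.

(** A closed set of the subspace A is the trace on A of a closed set of X;
    when A is closed this trace is closed in X. *)
Lemma closed_map_set_val (X : topologicalType) (A : set X) :
  closed A -> closed_map (set_val : A -> X).
Proof.
move=> Acl C Ccl; have [U Uop UE] := closed_openC Ccl.
suff -> : set_val @` C = A `&` ~` U.
  by apply: closedI => //; exact: open_closedC.
have inU (a : A) : U (set_val a) = (~` C) a by rewrite -UE.
apply/seteqP; split=> [_ [a Ca <-]|x [Ax nUx]].
  by split; [exact/set_mem/valP|rewrite /= inU /=; exact].
exists (exist _ x (mem_set Ax)) => //; apply: contrapT => nC.
by apply: nUx; rewrite -[x]/(set_val (exist _ x (mem_set Ax) : A)) inU.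
Qed.

Section CompactGroup.
Context {G : topologicalGroupType} {X : topologicalType}.
Variable eta : partial_action G X.

Lemma pa_inv_in (z : pa_dom eta) :
  (((val z).1^-1)%g, eta z) \in pa_dom eta.
Proof. by case: z => -[g x] gx; have [] := pa1 gx. Qed.

(** The inverse map of the action groupoid, whose arrows (g, x) go from x to
    g . x; it exchanges sources and targets. *)
Definition pa_inv (z : pa_dom eta) : pa_dom eta :=
  exist _ (((val z).1^-1)%g, eta z) (pa_inv_in z).

Lemma pa_map_inv (z : pa_dom eta) : eta (pa_inv z) = (val z).2.
Proof.
case: z => -[g x] gx; have [gVgx /= e] := pa1 gx.
by rewrite -[RHS]e; congr (pa_map eta _); exact: val_inj.
Qed.

Lemma pa_invK : involutive pa_inv.
Proof.
move=> z; apply: val_inj; rewrite /= pa_map_inv invgK.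
by rewrite -surjective_pairing.
Qed.

Hypothesis eta_continuous : continuous (pa_map eta).

Lemma pa_inv_continuous : continuous pa_inv.
Proof.
apply: continuous_to_set_type; apply: continuous_pair => //.
apply: (continuous_funcomp (f := fun z : pa_dom eta => (val z).1)).
  by apply: continuous_funcomp;
    [exact: set_val_continuous|exact: fst_continuous].
exact: invg_continuous.
Qed.

Hypotheses (G_compact : compact [set: G]) (dom_closed : closed (pa_dom eta)).

(** Through the involution [pa_inv], applying eta becomes projecting to X. *)
Lemma closed_pa_map : closed_map (pa_map eta).
Proof.
move=> C Ccl.
have -> : pa_map eta @` C = snd @` (set_val @` (pa_inv @^-1` C)).
  apply/seteqP; split=> [_ [z Cz <-]|_ [_ [z Cz <-] <-]].
    by exists (val (pa_inv z)) => //; exists (pa_inv z) => //=; rewrite pa_invK.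
  by exists (pa_inv z) => //; rewrite pa_map_inv.
apply: closed_map_snd => //; apply: closed_map_set_val => //.
by have /continuous_closedP := pa_inv_continuous; exact.
Qed.

Lemma pa_orbit_relP (x y : X) :
  pa_orbit_rel eta x y <-> exists2 z : pa_dom eta, (val z).2 = x & eta z = y.
Proof.
split=> [[g [gx gxy]]|[[[g x'] gx] /= <- <-]]; last by exists g, gx.
by exists (exist _ (g, x) gx).
Qed.

(** In the quotient topology the image of C is closed iff its saturation is
    closed in X, and the saturation is an image under the closed map eta. *)
Lemma closed_orbit_map : closed_map (orbit_map eta).
Proof.
move=> C Ccl; rewrite -openC.
suff sat : closed (orbit_map eta @^-1` (orbit_map eta @` C)).
  exact: (closed_openC sat).
have -> : orbit_map eta @^-1` (orbit_map eta @` C) =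
    pa_map eta @` ((snd \o set_val) @^-1` C).
  apply/seteqP; split=> [y [x Cx /orbit_map_eqP/pa_orbit_relP[z zx zy]]|].
    by exists z => //=; rewrite set_valE /= zx.
  move=> _ [z Cz <-]; exists (val z).2 => //.
  by apply/orbit_map_eqP/pa_orbit_relP; exists z.
apply: closed_pa_map.
have /continuous_closedP := continuous_funcomp
  (@set_val_continuous _ (pa_dom eta)) (@snd_continuous G X); exact.
Qed.

(** The compact set here is the part of G * X over x.  It is obtained inside
    G x X, as a closed part of G x {x}, rather than as the preimage of {x} in
    G * X, because points of X need not be closed. *)
Lemma compact_orbit (x : X) : compact [set y | pa_orbit_rel eta x y].
Proof.
(* Outside G * X the extension of eta takes the default value x. *)
have cvalL : {within pa_dom eta, continuous (valL_ x (pa_map eta))}.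
  exact/subspace_valL_continuousP'.
pose K := ([set: G] `*` [set x]) `&` pa_dom eta.
have Kcompact : compact K.
  apply: compact_closedI => //; apply: compact_setX => //.
  exact: compact_set1.
have valLE (z : pa_dom eta) : valL_ x (pa_map eta) (val z) = eta z.
  by rewrite -[LHS]/(sigL _ _ _) valLK.
have -> : [set y | pa_orbit_rel eta x y] = valL_ x (pa_map eta) @` K.
  apply/seteqP; split=> y.
    move=> /pa_orbit_relP[z zx <-].
    exists (val z); last exact: valLE.
    by split; [split|exact/set_mem/valP].
  move=> [[g x'] [[_ /= ->] gx] <-].
  apply/pa_orbit_relP; exists (exist _ (g, x) (mem_set gx)) => //.
  by rewrite -valLE.
apply: continuous_compact Kcompact; apply: continuous_subspaceW cvalL.
by move=> z [].
Qed.

Lemma perfect_orbit_map : perfect_map (orbit_map eta).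
Proof.
have surj (b : orbit_space eta) : exists x, orbit_map eta x = b.
  by exists (repr b); exact: reprK.
split.
- exact: pi_continuous.
- by apply/seteqP; split=> // b _; have [x <-] := surj b; exists x.
- exact: closed_orbit_map.
move=> b; have [x <-] := surj b.
rewrite (_ : _ @^-1` _ = [set y | pa_orbit_rel eta x y]).
  exact: compact_orbit.
by apply/seteqP; split=> y /= => [/esym|] /orbit_map_eqP.
Qed.

End CompactGroup.

Section HatTopology.
Context {G : topologicalGroupType} {X : topologicalType}.
Variable eta : partial_action G X.

Let act_part (p : G * (G * X)) : G * X := (p.1, p.2.2).

Let act_part_continuous : continuous act_part.
Proof.
apply: continuous_pair; first exact: fst_continuous.
by apply: continuous_funcomp; exact: snd_continuous.
Qed.

(** The domain of the action on G x X is the preimage of G * X under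
    (g, (h, x)) |-> (g, x). *)
Lemma closed_hat_dom : closed (pa_dom eta) -> closed (pa_dom (pa_hat eta)).
Proof. by have /continuous_closedP := act_part_continuous; exact. Qed.

Lemma hat_continuous :
  continuous (pa_map eta) -> continuous (pa_map (pa_hat eta)).
Proof.
move=> eta_continuous.
pose dom_part (p : hat_dom eta) : pa_dom eta :=
  exist _ ((val p).1, (val p).2.2) (hat_domP p).
have valc := @set_val_continuous _ (hat_dom eta).
apply: continuous_pair; last first.
  apply: (continuous_funcomp (f := dom_part)) eta_continuous.
  apply: continuous_to_set_type.
  exact: continuous_funcomp valc act_part_continuous.
apply: (continuous_funcomp (f := fun p : hat_dom eta =>
  ((val p).2.1, ((val p).1^-1)%g)) (g := fun z : G * G => (z.1 * z.2)%g));
  last exact: mulg_continuous.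
apply: continuous_pair.
  apply: (continuous_funcomp (f := fun p : hat_dom eta => (val p).2));
    last exact: fst_continuous.
  exact: continuous_funcomp valc (@snd_continuous _ _).
apply: (continuous_funcomp (f := fun p : hat_dom eta => (val p).1));
  last exact: invg_continuous.
exact: continuous_funcomp valc (@fst_continuous _ _).
Qed.

End HatTopology.

Theorem lemma3p1 (G : topologicalGroupType) (X : topologicalType)
    (eta : partial_action G X)
    (G_compact : compact [set: G]) (G_hausdorff : hausdorff_space G)
    (eta_topological : pa_topological eta)
    (eta_continuous : continuous (pa_map eta))
    (dom_closed : closed (pa_dom eta)) :
  closed_map (pa_map eta) /\
  (perfect_map (orbit_map eta) /\ perfect_map (orbit_map (pa_hat eta))).
Proof.
split; first exact: closed_pa_map.
split; first exact: perfect_orbit_map.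
apply: perfect_orbit_map => //; first exact: hat_continuous.
exact: closed_hat_dom.
Qed.
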